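(* There is an unbounded interval of the real line which is an antenna in the parameter plane of the family $O_b$, and which corresponds, under the change of parameter $$a(b)=\frac{11+6b-b^2}{-3+2b+b^2},$$ to the bounded antenna formed by the interval $\left(-\frac{5}{3},-1\right)$ in the parameter plane of the family $O_a$. That is: for every $a\in\left(-\frac53,-1\right)$ the orbits of the free critical points of $O_a$ converge neither to $0$ nor to $\infty$, and there is an unbounded interval $A\subset\mathbb{R}$ with $a(A)=\left(-\frac53,-1\right)$ such that for every $b\in A$ the orbits of the free critical points of $O_b$ converge neither to $0$ nor to $\infty$.
   Context: For $b\in\mathbb{C}$, $$O_b(z)=z^4\,\frac{-11-6b+b^2+(-3+2b+b^2)z}{-3+2b+b^2+(-11-6b+b^2)z},$$ and for $a\in\mathbb{C}$, $$O_a(z)=z^4\,\frac{z-a}{1-az},$$ both regarded as rational maps on the Riemann sphere $\widehat{\mathbb{C}}$ (after cancelling common factors). With $a=a(b)$ as in the claim (whenever $b^2+2b-3\neq0$) one has $O_b=O_{a(b)}$. The points $z=0$ and $z=\infty$ are superattracting fixed points. For $a\neq 0,\pm1$, the free critical points of $O_a$ are the critical points different from $0$ and $\infty$, namely $$c_{\pm}=\frac{5+3a^2\pm\sqrt{(a+1)(a-1)(3a-5)(3a+5)}}{8a};$$ the free critical points of $O_b$ are those of $O_{a(b)}$. An antenna (on the real line) is an interval of real parameters for which the orbits of the free critical points converge neither to $0$ nor to $\infty$. *)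

(* Defs.v *)
From mathcomp Require Import all_boot all_order all_algebra.
From mathcomp Require Import all_classical all_reals all_analysis.
From mathcomp Require Export complex.

Set Implicit Arguments.
Unset Strict Implicit.
Unset Printing Implicit Defensive.

Import Order.TTheory GRing.Theory Num.Theory.
Import numFieldNormedType.Exports.

Local Open Scope classical_set_scope.
Local Open Scope ring_scope.
Local Open Scope complex_scope.

(* The Riemann sphere is [one_point_compactification K] for [K := R[i]], with
   its library topology; as a type it is [option K], the finite point z being
   [Some z] and infinity being [None]. *)
Notation sphere K := (one_point_compactification K).

Section RationalMaps.
Variable K : numFieldType.

(* The point [u : v] of the projective line, for (u, v) <> (0, 0). *)
Definition proj_point (u v : K) : sphere K :=
  if v == 0 then None else Some (u / v).

(* The rational map p / q (q <> 0) on the sphere. After division by the gcd,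
   it is [p1 : q1] at finite points; at infinity both polynomials are
   homogenized in degree d = max (deg p1) (deg q1), and [p : q] is evaluated
   at the point [1 : 0], which leaves the coefficients of degree d. *)
Definition ratmap (p q : {poly K}) : sphere K -> sphere K :=
  let p1 := p %/ gcdp p q in
  let q1 := q %/ gcdp p q in
  let d := (maxn (size p1) (size q1)).-1 in
  fun x : sphere K =>
    match x with
    | Some z => proj_point p1.[z] q1.[z]
    | None => proj_point p1`_d q1`_d
    end.

(* z |-> 1 / z, exchanging 0 and infinity: the chart at infinity. *)
Definition sphere_inv : sphere K -> sphere K :=
  fun x : sphere K => if x is Some z then proj_point 1 z else Some 0.

(* x is a critical point of f: the complex derivative of f, read in the chart
   z or 1 / z at x and in the chart z or 1 / z at f x, vanishes. In the chart
   used, x has coordinate [odflt 0 x]; the value 0 given by the second [odflt]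
   to infinity is irrelevant when f is continuous, since F is finite at x. *)
Definition critical_point (f : sphere K -> sphere K) (x : sphere K) : Prop :=
  let g := if x is Some _ then f else f \o sphere_inv in
  let F := if f x is Some _ then g else sphere_inv \o g in
  is_derive (odflt 0 x : K) 1 (fun w : K => odflt 0 (F (Some w)) : K) 0.

Definition free_critical_point (f : sphere K -> sphere K) (x : sphere K) :=
  [/\ critical_point f x, x <> Some 0 & x <> None].

Definition orbit_cvg_to (f : sphere K -> sphere K) (x l : sphere K) : Prop :=
  (fun n : nat => iter n f x) @ \oo --> l.

Definition Oa (a : K) : sphere K -> sphere K :=
  ratmap ('X^4 * ('X - a%:P)) (1 - a *: 'X).

Definition Ob (b : K) : sphere K -> sphere K :=
  ratmap
    ('X^4 * ((- 11 - 6 * b + b ^+ 2)%:P + (- 3 + 2 * b + b ^+ 2) *: 'X))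
    ((- 3 + 2 * b + b ^+ 2)%:P + (- 11 - 6 * b + b ^+ 2) *: 'X).

End RationalMaps.

(* When b^2 + 2b - 3 = 0 (b = 1 or b = -3) this is 0, as x / 0 = 0. *)
Definition a_of_b (R : realType) (b : R) : R :=
  (11 + 6 * b - b ^+ 2) / (- 3 + 2 * b + b ^+ 2).

Definition antenna (R : realType) (O : R[i] -> sphere R[i] -> sphere R[i])
    (I : set R) : Prop :=
  is_interval I /\
  forall t : R, I t -> forall c : sphere R[i],
    free_critical_point (O t%:C) c ->
    ~ orbit_cvg_to (O t%:C) c (Some 0) /\ ~ orbit_cvg_to (O t%:C) c None.

(* Main.v *)
(* For -5/3 < a < -1 the free critical points of O_a are the roots of
   4 a z^2 - (5 + 3 a^2) z + 4 a, whose discriminant is negative: they are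
   complex conjugates with product 1, hence lie on the unit circle. The circle
   is invariant under O_a, because a is real and |z| = 1 gives
   |z - a| = |1 - a z|, so their orbits stay away from 0 and infinity. For
   b < -3, a(b) = -1 + 8 (b + 1) / ((b + 3) (b - 1)) lies in (-5/3, -1) exactly
   when b^2 + 14 b + 9 > 0, that is when b < -7 - sqrt 40. *)
Require Import Defs.
From mathcomp Require Import all_boot all_order all_algebra.
From mathcomp Require Import all_classical all_reals all_analysis.
From mathcomp Require Import ring lra.

Import Order.TTheory GRing.Theory Num.Theory.
Import numFieldNormedType.Exports.

Local Open Scope classical_set_scope.
Local Open Scope ring_scope.

(** * Evaluation and critical points of rational maps *)

Lemma ratmap_coprime (K : numFieldType) (p q : {poly K}) (z : K) :
  coprimep p q -> ratmap p q (Some z) = proj_point p.[z] q.[z].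
Proof.
(* Coprimality makes [gcdp p q] a nonzero constant, not necessarily 1; it cancels in the
   quotient. *)
rewrite coprimep_def => /size_poly1P[c c0 gcdE].
have pE := divpK (dvdp_gcdl p q); have qE := divpK (dvdp_gcdr p q).
rewrite gcdE in pE qE; rewrite /ratmap gcdE -{2}pE -{2}qE.
rewrite !hornerM !hornerC /proj_point mulf_eq0 (negPf c0) orbF.
by rewrite invfM mulrACA divff// mulr1.
Qed.

Lemma ratmapZ_coprime (K : numFieldType) (t : K) (p q : {poly K}) (z : K) :
  t != 0 -> coprimep p q ->
  ratmap (t *: p) (t *: q) (Some z) = proj_point p.[z] q.[z].
Proof.
move=> t0 pq; rewrite ratmap_coprime; last by rewrite coprimepZl// coprimepZr.
by rewrite !hornerZ /proj_point mulf_eq0 (negPf t0) invfM mulrACA divff// mul1r.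
Qed.

Lemma is_derive_horner (K : numFieldType) (p : {poly K}) (x : K) :
  is_derive x (1 : K) (horner p) p^`().[x].
Proof.
elim/poly_ind: p => [|p c IH].
  have -> : horner (0 : {poly K}) = cst 0 by apply/funext => y; rewrite horner0.
  by rewrite deriv0 horner0; exact: is_derive_cst.
have -> : horner (p * 'X + c%:P) = horner p * id + cst c.
  by apply/funext => y; rewrite !hornerE.
have D := is_deriveD (is_deriveM IH (is_derive_id x 1)) (is_derive_cst c x 1).
refine (is_derive_eq D _).
by rewrite derivD derivM derivX derivC !hornerE /GRing.scale /=; ring.
Qed.

(** At a pole both sides are 0: the default read at infinity and the convention [u / 0 = 0]. *)
Lemma odflt_proj_point (K : numFieldType) (u v : K) :
  odflt 0 (proj_point u v) = u / v.
Proof. by rewrite /proj_point; case: eqP => [->|//]; rewrite invr0 mulr0. Qed.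

Lemma odflt_sphere_inv_proj_point (K : numFieldType) (u v : K) :
  odflt 0 (sphere_inv (proj_point u v)) = v / u.
Proof.
rewrite /proj_point; case: eqP => [->|_]; first by rewrite mul0r.
by rewrite /= odflt_proj_point div1r invf_div.
Qed.

Lemma is_derive0_ratio (K : numFieldType) (p q : {poly K}) (z : K) :
  q.[z] != 0 -> is_derive z (1 : K) (fun w : K => p.[w] / q.[w] : K) 0 ->
  p^`().[z] * q.[z] = p.[z] * q^`().[z].
Proof.
move=> qz0 dF.
have dq := is_derive_horner _ q z; have dp := is_derive_horner _ p z.
have xq := @ex_derive _ _ _ _ _ _ _ dq.
have dV : is_derive z (1 : K) (fun w : K => (q.[w])^-1 : K)
    (- q.[z] ^- 2 *: q^`().[z]).
  apply: DeriveDef; first exact: derivableV.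
  by rewrite (deriveV qz0 xq) derive_val.
have dF' := is_deriveM dp dV.
have : p.[z] *: (- q.[z] ^- 2 *: q^`().[z]) + (q.[z])^-1 *: p^`().[z] = 0.
  by rewrite -(@derive_val _ _ _ _ _ _ _ dF') -(@derive_val _ _ _ _ _ _ _ dF).
(* Multiplying the quotient rule by [q.[z] ^+ 2] clears the denominators. *)
rewrite /GRing.scale /= => /(congr1 ( *%R (q.[z] ^+ 2))); rewrite mulr0 => E.
apply/eqP; rewrite -subr_eq0 -E; apply/eqP; field.
exact: qz0.
Qed.

(* At a pole the chart 1 / z at the image turns p / q into q / p, whose
   derivative vanishes under the same equation. *)
Lemma critical_point_wronskian (K : numFieldType) (f : sphere K -> sphere K)
    (p q : {poly K}) (z : K) :
  (forall w : K, f (Some w) = proj_point p.[w] q.[w]) ->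
  (p.[z] != 0) || (q.[z] != 0) -> critical_point f (Some z) ->
  p^`().[z] * q.[z] = p.[z] * q^`().[z].
Proof.
move=> fE pq0; rewrite /critical_point /= fE {1}/proj_point.
case: eqP => [qz0|/eqP qz0].
  rewrite qz0 eqxx orbF in pq0.
  have -> : (fun w : K => odflt 0 ((@sphere_inv K \o f) (Some w)) : K) =
            (fun w : K => q.[w] / p.[w] : K).
    by apply/funext => w; rewrite /= fE odflt_sphere_inv_proj_point.
  by move=> /(is_derive0_ratio _ _ _ _ pq0) E; rewrite [RHS]mulrC E mulrC.
have -> : (fun w : K => odflt 0 (f (Some w)) : K) =
          (fun w : K => p.[w] / q.[w] : K).
  by apply/funext => w; rewrite fE odflt_proj_point.
exact: is_derive0_ratio.
Qed.

(** * Blaschke factors on the unit circle *)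

Lemma coprimep_blaschke (K : numFieldType) (a : K) :
  a ^+ 2 != 1 -> coprimep ('X^4 * ('X - a%:P)) (1 - a *: 'X).
Proof.
(* The numerator vanishes only at 0 and a, where the denominator is 1 and 1 - a^2. *)
move=> a21; rewrite coprimepMl coprimep_expl/=; last first.
  by rewrite coprimep_sym -['X]subr0 -polyC0 coprimep_XsubC /root !hornerE
             oppr0 mulr0 subr0 oner_eq0.
rewrite coprimep_sym coprimep_XsubC /root !hornerE.
by rewrite subr_eq0 eq_sym.
Qed.

(** On the circle z has inverse its conjugate, so 1 - a z is z times the conjugate of z - a. *)
Lemma norm_blaschke (K : numClosedFieldType) (a z : K) :
  a \is Num.real -> `|z| = 1 -> `|z - a| = `|1 - a * z|.
Proof.
move=> /CrealP aJ z1; have zz : z * z^* = 1 by rewrite -normCK z1 expr1n.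
have -> : 1 - a * z = z * (z - a)^*.
  by rewrite rmorphB /= aJ mulrBr zz [z * a]mulrC.
by rewrite normrM z1 mul1r norm_conjC.
Qed.

Lemma unit_circle_orbit (K : numClosedFieldType) (a z : K)
    (f : sphere K -> sphere K) :
  a \is Num.real -> a ^+ 2 != 1 ->
  (forall w : K, f (Some w) = proj_point (w ^+ 4 * (w - a)) (1 - a * w)) ->
  `|z| = 1 -> forall n, exists2 w : K, iter n f (Some z) = Some w & `|w| = 1.
Proof.
move=> aR a21 fE z1; elim=> [|n [w /= -> w1]]; first by exists z.
have waE := norm_blaschke _ _ _ aR w1.
(* Were w equal to a, then a would be real of modulus 1, against a^2 != 1. *)
have wa0 : w - a != 0.
  apply: contra_neq a21 => /subr0_eq wa.
  by rewrite -wa -real_normK ?w1 ?expr1n// wa.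
have aw0 : 1 - a * w != 0 by rewrite -normr_eq0 -waE normr_eq0.
exists (w ^+ 4 * (w - a) / (1 - a * w)); first by rewrite fE /proj_point ifN.
by rewrite normf_div normrM normrX w1 waE expr1n mul1r divff ?normr_eq0.
Qed.

(** * Separation of the unit circle from 0 and infinity; location of the free critical points *)

Section UnitCircle.
Variable R : realType.
Local Notation C := (R[i] : numFieldType).
Local Open Scope complex_scope.

Lemma real_complex_continuous : continuous (fun x : R => x%:C : C).
Proof.
move=> x; apply/cvgrPdist_lt => /= e e0.
(* A positive element of [R[i]] is real, so the estimate can be carried out in [R]. *)
have eE : e = (complex.Re e)%:C.
  by rewrite RRe_real// gtr0_real.
rewrite eE in e0 *; rewrite ltcR in e0.
near=> y; rewrite -rmorphB normc_def/= expr0n/= addr0 sqrtr_sqr ltcR.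
near: y.
exact: (@cvgr_dist_lt _ _ _ _ _ id x).
Unshelve. all: by end_near. Qed.

(* A compact set containing the unit circle; its complement is a neighbourhood
   of infinity. *)
Lemma compact_unit_square :
  compact [set z : C | `|complex.Re z| <= 1 /\ `|complex.Im z| <= 1].
Proof.
pose f := fun p : R * R => p.1%:C + 'i%C * p.2%:C : C.
have -> : [set z : C | `|complex.Re z| <= 1 /\ `|complex.Im z| <= 1] =
          f @` (`[(-1 : R), 1] `*` `[(-1 : R), 1]).
  apply/seteqP; split => [z [x1 y1]|_ [[x y] /= [x1 y1] <-]].
    exists (complex.Re z, complex.Im z); last by rewrite [RHS]complexE.
    by rewrite /= !in_itv/= -!ler_norml.
  have -> : f (x, y) = x +i* y by rewrite [RHS]complexE.
  by rewrite /= !ler_norml; move: x1 y1; rewrite !in_itv.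
apply: continuous_compact; last first.
  by apply: compact_setX; exact: segment_compact.
apply: continuous_subspaceT => p; apply: cvgD.
  by apply: (continuous_comp cvg_fst); exact: real_complex_continuous.
apply: cvgM; first exact: cvg_cst.
by apply: (continuous_comp cvg_snd); exact: real_complex_continuous.
Qed.

Lemma unit_circle_not_cvg0 (u : nat -> sphere C) :
  (forall n, exists2 w : C, u n = Some w & `|w| = 1) ->
  ~ (u @ \oo --> (Some 0 : sphere C)).
Proof.
move=> uS u0; have : (u @ \oo) (Some @` ball (0 : C) 1).
  by apply: u0; apply: one_point_compactification_some_nbhs; exact: nbhsx_ballx.
case=> n _ /(_ n (leqnn n)) [w].
have [v -> v1] := uS n; rewrite -ball_normE /ball_/= sub0r normrN => w1 [wv].
by move: w1; rewrite wv v1 ltxx.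
Qed.

Lemma unit_circle_not_cvg_infty (u : nat -> sphere C) :
  (forall n, exists2 w : C, u n = Some w & `|w| = 1) ->
  ~ (u @ \oo --> (None : sphere C)).
Proof.
move=> uS.
pose S := [set z : C | `|complex.Re z| <= 1 /\ `|complex.Im z| <= 1].
move=> ucvg; have : (u @ \oo) ((Some @` (~` S)) `|` [set None]).
  apply: ucvg; exists S => //; split; first exact: compact_unit_square.
  by apply: compact_closed; [exact: norm_hausdorff|exact: compact_unit_square].
case=> n _ /(_ n (leqnn n)) /=; have [v -> v1] := uS n.
case=> // -[w /= Sw [wv]]; apply: Sw; subst w.
have := normr_ge0 v; have := add_Re2_Im2 v.
(* Re^2 + Im^2 = 1 bounds both coordinates by 1, so the circle lies in [S]. *)
rewrite v1 expr1n => /complexI vE _.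
rewrite /S /= !ler_norml; split; nra.
Qed.

Lemma critical_equation_norm (a : R) (z : R[i]) :
  - (5 / 3) < a < - 1 ->
  4 * a%:C * z ^+ 2 - (5 + 3 * a%:C ^+ 2) * z + 4 * a%:C = 0 -> `|z| = 1.
Proof.
move=> /andP[a1 a2]; case: z => x y.
rewrite -(rmorph_nat (real_complex R) 4) -(rmorph_nat (real_complex R) 5).
rewrite -(rmorph_nat (real_complex R) 3) -rmorphXn -!rmorphM -rmorphD.
rewrite normc_def /= expr2; simpc => -[re im].
suff -> : x ^+ 2 + y ^+ 2 = 1 by rewrite sqrtr1.
have a0 : a != 0 by lra.
have [y0|y0] := eqVneq y 0; last first.
  (* For y != 0 the imaginary part yields this relation, which turns the real part into 4 a (x^2 +
     y^2) = 4 a. *)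
  have {}im : 8 * a * x = 5 + 3 * a ^+ 2.
    by apply: (mulIf y0); apply/eqP; rewrite -subr_eq0 -im; apply/eqP; ring.
  apply: (mulfI a0); apply: (@mulfI _ 4); first by rewrite pnatr_eq0.
  by apply/eqP; rewrite eq_sym -subr_eq0 -re -im; apply/eqP; ring.
(* A real root is impossible: completing the square (factor 16 a) equates a square with the negative
   discriminant. *)
have disc : (8 * a * x - (5 + 3 * a ^+ 2)) ^+ 2 =
            - (((- 1 - a) * (3 * a + 5)) * ((1 - a) * (5 - 3 * a))).
  apply/eqP; rewrite -subr_eq0 -(mulr0 (16 * a)) -re y0; apply/eqP; ring.
have := sqr_ge0 (8 * a * x - (5 + 3 * a ^+ 2)).
rewrite disc oppr_ge0 leNgt => /negP[].
by apply: mulr_gt0; apply: mulr_gt0; lra.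
Qed.

End UnitCircle.

(** The factor z^3 accounts for the critical point 0, the quadratic for the free ones. *)
Lemma wronskian_blaschke (K : numFieldType) (a z : K) :
  let p : {poly K} := 'X^4 * ('X - a%:P) in let q : {poly K} := 1 - a *: 'X in
  p^`().[z] * q.[z] - p.[z] * q^`().[z] =
  - (z ^+ 3 * (4 * a * z ^+ 2 - (5 + 3 * a ^+ 2) * z + 4 * a)).
Proof.
rewrite /= derivM derivB derivXn derivX derivC derivB derivZ derivX.
by rewrite -polyC1 derivC !hornerE /=; ring.
Qed.

(** * The antennas of both families and the change of parameter *)

Section Antenna.
Variable R : realType.
Local Notation C := (R[i] : numFieldType).
Local Open Scope complex_scope.

Lemma sqr_neq1 (a : R) : - (5 / 3) < a < - 1 -> (a%:C : C) ^+ 2 != 1.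
Proof.
move=> /andP[? ?].
rewrite -rmorphXn -(rmorph1 (real_complex R)) (inj_eq (@complexI R)).
by apply/eqP; nra.
Qed.

(** Prescribing [f] only at finite points lets this serve both [Oa a] and [Ob b]. *)
Lemma free_critical_orbit_not_cvg (a : R) (f : sphere C -> sphere C) :
  - (5 / 3) < a < - 1 ->
  (forall w : C, f (Some w) = proj_point (('X^4 * ('X - (a%:C : C)%:P)).[w] : C)
                                         ((1 - (a%:C : C) *: 'X).[w] : C)) ->
  forall c : sphere C, free_critical_point f c ->
  ~ orbit_cvg_to f c (Some 0) /\ ~ orbit_cvg_to f c None.
Proof.
move=> aI fE [z [fz z0 _]|[_ _]//].
have a21 := sqr_neq1 _ aI.
have pq0 : (('X^4 * ('X - (a%:C : C)%:P)).[z] != 0) ||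
           ((1 - (a%:C : C) *: 'X).[z] != 0).
  case: eqP => //= /eqP; exact: coprimep_root (coprimep_blaschke _ _ a21).
have /eqP := critical_point_wronskian _ _ _ _ _ fE pq0 fz.
rewrite -subr_eq0 wronskian_blaschke oppr_eq0 mulf_eq0 expf_eq0/=.
case/orP => [/eqP ze|/eqP /(critical_equation_norm _ _ _ aI) z1].
  by rewrite ze in z0.
have /= orb := unit_circle_orbit _ _ _ f _ a21 _ z1.
have {}orb n : exists2 w : C, iter n f (Some z) = Some w & `|w| = 1.
  apply: orb; first by rewrite complex_real.
  by move=> w; rewrite fE !hornerE.
split; [exact: unit_circle_not_cvg0 | exact: unit_circle_not_cvg_infty].
Qed.

Lemma antenna_Oa : antenna (@Oa R[i]) `]- (5 / 3), - 1[%classic.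
Proof.
split; first exact: interval_is_interval.
move=> a; rewrite /= in_itv/= => aI.
apply: (free_critical_orbit_not_cvg a) => //.
by move=> w; apply: ratmap_coprime; apply: coprimep_blaschke; exact: sqr_neq1.
Qed.

(** With t = b^2 + 2 b - 3, the numerator and denominator of O_b are t times those of O_a(b). *)
Lemma Ob_a_of_b (b : R) (w : C) : - 3 + 2 * b + b ^+ 2 != 0 ->
  (a_of_b b)%:C ^+ 2 != 1 :> C ->
  Ob (b%:C : C) (Some w) =
  proj_point (('X^4 * ('X - ((a_of_b b)%:C : C)%:P)).[w] : C)
             ((1 - ((a_of_b b)%:C : C) *: 'X).[w] : C).
Proof.
move=> t0 a21; set t := - 3 + 2 * b + b ^+ 2 in t0.
rewrite -(@ratmapZ_coprime _ (t%:C : C)); last exact: coprimep_blaschke.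
  rewrite /Ob.
  have tE : - 3 + 2 * b%:C + b%:C ^+ 2 = t%:C :> C.
    by rewrite /t !rmorphD rmorphXn !rmorphM rmorphN !rmorph_nat.
  have mE : - 11 - 6 * b%:C + b%:C ^+ 2 = - (t%:C * (a_of_b b)%:C) :> C.
    have atE : t * a_of_b b = 11 + 6 * b - b ^+ 2.
      by rewrite /a_of_b mulrC divfK.
    rewrite -rmorphM atE !rmorphD rmorphN rmorphXn !rmorphM !rmorph_nat !opprD.
    by rewrite opprK.
  rewrite tE mE; congr (ratmap _ _ _).
    by rewrite -!mul_polyC !rmorphN !rmorphM; ring.
  by rewrite -!mul_polyC !rmorphN !rmorphM; ring.
by rewrite -(rmorph0 (real_complex R)) (inj_eq (@complexI R)).
Qed.

Lemma lt_root_quadratic (b : R) :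
  (b < - 7 - Num.sqrt 40) = (b < - 3) && (0 < b ^+ 2 + 14 * b + 9).
Proof.
have s40 : Num.sqrt 40 ^+ 2 = 40 :> R by rewrite sqr_sqrtr// ler0n.
have s0 : 0 <= Num.sqrt 40 :> R by exact: sqrtr_ge0.
move: (Num.sqrt 40) s40 s0 => s s40 s0.
have -> : b ^+ 2 + 14 * b + 9 = (- 7 - s - b) * (- 7 + s - b) by nra.
(* The larger root -7 + s exceeds -1, so for b < -3 the second factor is positive. *)
have s6 : 6 < s by nra.
apply/idP/andP => [bs|[b3]]; first by split; [lra | apply: mulr_gt0; lra].
by rewrite pmulr_lgt0; lra.
Qed.

Lemma a_of_b_bounds (b : R) : b < - 7 - Num.sqrt 40 ->
  0 < - 3 + 2 * b + b ^+ 2 /\ - (5 / 3) < a_of_b b < - 1.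
Proof.
rewrite lt_root_quadratic => /andP[b3 bq].
have t0 : 0 < - 3 + 2 * b + b ^+ 2 by nra.
(* With the denominator cleared, the lower bound reads b^2 + 14 b + 9 > 0 and the upper one b <
   -1. *)
split=> //; rewrite /a_of_b ltr_pdivlMr// ltr_pdivrMr//.
by apply/andP; split; nra.
Qed.

Lemma a_of_b_surj (a : R) : - (5 / 3) < a < - 1 ->
  exists2 b : R, b < - 7 - Num.sqrt 40 & a_of_b b = a.
Proof.
move=> /andP[a1 a2].
(* A quarter of the discriminant of (a + 1) u^2 - 8 u - 4 (a + 1), whose negative root will be
   [u]. *)
have d0 : 0 <= 16 + 4 * (a + 1) ^+ 2 by nra.
have := sqr_sqrtr d0; have := sqrtr_ge0 (16 + 4 * (a + 1) ^+ 2).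
move: (Num.sqrt _) => r r0 r2.
have s0 : a + 1 < 0 by lra.
(* With u = b + 1, the equation a(b) = a reads (a + 1) (u^2 - 4) = 8 u. *)
pose u := (4 + r) / (a + 1).
have uE : u * (a + 1) = 4 + r by rewrite divfK// lt_eqF.
have u_neg : u < - 2 by nra.
have uq : (a + 1) * (u ^+ 2 - 4) = 8 * u.
  apply: (@mulIf _ (a + 1)); first by rewrite lt_eqF.
  nra.
exists (u - 1).
  (* The second condition is u^2 + 12 u - 4 > 0; it follows from [uq] because -2/3 < a + 1 < 0 and u
     < -2. *)
  rewrite lt_root_quadratic; apply/andP; split; first lra.
  nra.
have t0 : - 3 + 2 * (u - 1) + (u - 1) ^+ 2 != 0 by apply/eqP; nra.
apply: (mulIf t0); rewrite /a_of_b divfK//; nra.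
Qed.

End Antenna.

Lemma left_ray_unbounded (R : realType) (c : R) :
  ~ bounded_set `]-oo, c[%classic.
Proof.
move=> [M [_ bnd]]; pose N : R := `|M| + 1.
have N_ge1 : 1 <= N by rewrite lerDr.
(* [N] exceeds [M], hence bounds the ray, yet this point left of c has absolute value above [N]. *)
have : `|- (N + `|c| + 1)| <= N.
  apply: (bnd N); first by rewrite (le_lt_trans (ler_norm M))// ltrDl.
  by rewrite /= in_itv/=; have := ler_norm (- c); rewrite normrN; lra.
by rewrite normrN ger0_norm; have := normr_ge0 c; lra.
Qed.

Theorem proposition12 (R : realType) :
  antenna (@Oa R[i]) `]- (5 / 3), - 1[%classic /\
  exists A : set R,
    [/\ ~ bounded_set A,
        antenna (@Ob R[i]) A &
        @a_of_b R @` A = `]- (5 / 3), - 1[%classic].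
Proof.
split; first exact: antenna_Oa.
exists `]-oo, - 7 - Num.sqrt 40[%classic; split.
- exact: left_ray_unbounded.
- split; first exact: interval_is_interval.
  move=> b /=; rewrite in_itv/= => /a_of_b_bounds[t0 aI].
  apply: (free_critical_orbit_not_cvg _ (a_of_b b)) => // w.
  by apply: Ob_a_of_b; [rewrite gt_eqF|exact: sqr_neq1].
- apply/seteqP; split => [_ [b /= bI <-]|a /=]; rewrite in_itv/=.
    by rewrite in_itv/= in bI; have [] := a_of_b_bounds _ _ bI.
  by move=> /a_of_b_surj[b bI <-]; exists b => //=; rewrite in_itv.
Qed.
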